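(* The hyperbolic cover $\tilde W$ of a tubular elliptic Weyl system is not a Coxeter group (i.e. there is no subset $Q\subseteq\tilde W$ such that $(\tilde W,Q)$ is a Coxeter system).
   Context: Root systems. Let $V$ be a finite-dimensional real vector space with a symmetric bilinear form $(-\mid-)$ with radical $R$. For a vector $\alpha$ with $(\alpha\mid\alpha)\ne0$ put $s_\alpha(v)=v-\frac{2(\alpha\mid v)}{(\alpha\mid\alpha)}\alpha$. A generalized root system is a non-empty set $\Phi\subseteq V$ of non-isotropic vectors with $\mathrm{span}_{\mathbb R}(\Phi)=V$, $s_\alpha(\Phi)\subseteq\Phi$ for all $\alpha\in\Phi$, and $\frac{2(\alpha\mid\beta)}{(\beta\mid\beta)}\in\mathbb Z$ for all $\alpha,\beta\in\Phi$; its root lattice $L(\Phi)=\mathrm{span}_{\mathbb Z}(\Phi)$ is a lattice in $V$ (generated by an $\mathbb R$-basis of $V$). It is reduced if $r\alpha\in\Phi$ ($\alpha\in\Phi$, $r\in\mathbb R$) implies $r=\pm1$, and irreducible if it is not a union of two mutually orthogonal generalized root systems. It is elliptic if it is irreducible and reduced and $(-\mid-)$ has signature $(n,0,2)$ (numbers of positive, negative, zero eigenvalues), $n+2=\dim V$. Standing assumption: $(\alpha\mid\alpha)=2$ for all $\alpha\in\Phi$. Choices. Fix a $1$-dimensional subspace $U\le R$ with $U\cap L(\Phi)\ne\{0\}$ and $a$ with $L(\Phi)\cap U=\mathbb Za$. The image $\Phi/U$ of $\Phi$ in $V/U$ is an irreducible affine root system; let $\beta_0,\dots,\beta_n$ be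 a root basis (simple system) of it such that $\beta_1,\dots,\beta_n$ is a root basis of a finite root system ($\beta_0$ being the affine node in the standard numbering), and let $m_1,\dots,m_n$ be the unique positive integers such that $\beta_0+\sum_{i=1}^n m_i\beta_i$ spans $L(\Phi/U)\cap R/U$; put $m_0=1$. Choose preimages $\alpha_i\in\Phi$ of $\beta_i$ and put $b=\sum_{i=0}^n m_i\alpha_i\in R$, $V_{\mathrm{fin}}=\sum_{i=1}^n\mathbb R\alpha_i$. Tubular case. $\Phi$ is tubular if exactly one index $t$ satisfies $m_t=\max_i m_i$; then put $\alpha_{t^\star}=\alpha_t+a$, $M=\{0,\dots,n,t^\star\}$, $s_i=s_{\alpha_i}$, $S=\{s_i\mid i\in M\}$ and $W=\langle s_\alpha\mid\alpha\in\Phi\rangle\le \mathrm{GL}(V)$; $(W,S)$ is called a tubular elliptic Weyl system. Hyperbolic cover. Let $\hat V\supseteq V$ be the space with non-degenerate form of signature $(n+2,2,0)$ extending that of $V$, $\hat V=V_{\mathrm{fin}}\perp\langle a,a'\rangle\perp\langle b,b'\rangle$ with $(a,a'),(b,b')$ hyperbolic pairs (isotropic vectors with product $1$), and let $\tilde V=V\oplus\mathbb Rb'\subset\hat V$. For $i\in M$ let $\tilde s_i$ be the reflection of $\tilde V$ with respect to $\alpha_i$; $\tilde S=\{\tilde s_i\mid i\in M\}$, $\tilde W=\langle\tilde S\rangle$. *)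

(* Defs.v *)
From HB Require Import structures.
From mathcomp Require Import all_boot all_order all_algebra.
From mathcomp Require Import all_classical all_reals.

Set Implicit Arguments.
Unset Strict Implicit.
Unset Printing Implicit Defensive.

Import Order.TTheory GRing.Theory Num.Theory.
Local Open Scope classical_set_scope.
Local Open Scope ring_scope.

Section Spans.
Variables (R : realType) (V : vectType R).

Definition real_span (X : set V) : set V :=
  [set v | exists2 s : seq V, [set` s] `<=` X & v \in <<s>>%VS].

Definition int_span (X : set V) : set V :=
  [set v | exists k (s : k.-tuple V), [set` s] `<=` X /\ inIntSpan s v].

Definition is_lattice (U : {vspace V}) (L : set V) : Prop :=
  exists2 e : (\dim U).-tuple V, basis_of U e & L = [set v | inIntSpan e v].

End Spans.

Section Forms.
Variables (R : realType) (V : vectType R).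
Implicit Types B : {symmetric V}.

Definition gram B k (e : k.-tuple V) : 'M[R]_k :=
  \matrix_(i < k, j < k) B (tnth e i) (tnth e j).

(* The eigenvalues, listed with multiplicity, are those of Gram matrices. By
   Sylvester's law of inertia the three numbers do not depend on the basis. *)
Definition has_signature B (p q r : nat) : Prop :=
  forall e : (\dim {:V}).-tuple V, basis_of {:V} e ->
  exists s : seq R,
    [/\ char_poly (gram B e) = \prod_(x <- s) ('X - x%:P),
        count (fun x => 0 < x) s = p,
        count (fun x => x < 0) s = q
      & count (fun x => x == 0) s = r].

Definition radical B : {vspace V} := orthov B fullv.

Definition reflection B (alpha v : V) : V :=
  v - (2 * B alpha v / B alpha alpha) *: alpha.

Definition hyperbolic_pair B (x y : V) : Prop :=
  [/\ B x x = 0, B y y = 0 & B x y = 1].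

End Forms.

Section RestrictedForm.
Variables (R : realType) (V : vectType R) (B : {symmetric V}) (U : {vspace V}).

Definition restr_form (x y : subvs_of U) : R := B (vsval x) (vsval y).

Fact restr_form_bilinear :
  bilinear_for (GRing.Scale.Law.clone _ _ *%R _)
    (GRing.Scale.Law.clone _ _ (idfun \; *%R) _) restr_form.
Proof.
by split=> u k x y; rewrite /restr_form linearP //= linearPl.
Qed.

Fact restr_form_sym x y :
  restr_form x y = (-1) ^+ false * idfun (restr_form y x).
Proof. by rewrite /restr_form hermC. Qed.

HB.instance Definition _ :=
  bilinear_isBilinear.Build R (subvs_of U) (subvs_of U) R _ _ restr_form
    restr_form_bilinear.
HB.instance Definition _ :=
  isHermitianSesquilinear.Build R (subvs_of U) false idfun restr_form
    restr_form_sym.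

End RestrictedForm.

Section RootSystems.
Variables (R : realType) (V : vectType R) (B : {symmetric V}).
Implicit Types (Phi : set V) (U : {vspace V}).

Record generalized_root_system U Phi : Prop := GeneralizedRootSystem {
  grs_nonempty : Phi !=set0;
  grs_nonisotropic : forall alpha, Phi alpha -> B alpha alpha != 0;
  grs_span : real_span Phi = [set` U];
  grs_reflection : forall alpha beta,
    Phi alpha -> Phi beta -> Phi (reflection B alpha beta);
  grs_integral : forall alpha beta,
    Phi alpha -> Phi beta -> 2 * B alpha beta / B beta beta \is a Num.int;
  grs_lattice : is_lattice U (int_span Phi)
}.

Definition reduced Phi : Prop :=
  forall alpha r, Phi alpha -> Phi (r *: alpha) -> r = 1 \/ r = -1.

Definition irreducible Phi : Prop :=
  ~ exists (U1 U2 : {vspace V}) (Phi1 Phi2 : set V),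
      [/\ generalized_root_system U1 Phi1,
          generalized_root_system U2 Phi2,
          Phi = Phi1 `|` Phi2
        & forall x y, Phi1 x -> Phi2 y -> B x y = 0].

Definition elliptic_root_system (n : nat) Phi : Prop :=
  [/\ generalized_root_system fullv Phi, irreducible Phi, reduced Phi
    & has_signature B n 0 2].

Definition root_basis (k : nat) Phi (beta : 'I_k -> V) : Prop :=
  [/\ forall i, Phi (beta i),
      free [seq beta i | i : 'I_k]
    & forall x, Phi x -> exists c : 'I_k -> nat,
        x = \sum_i beta i *+ c i \/ x = - \sum_i beta i *+ c i].

End RootSystems.

Section AffineQuotient.
Variables (R : realType) (V Vq : vectType R).
Variables (B : {symmetric V}) (Bq : {symmetric Vq}) (pi : 'Hom(V, Vq)).

(* (Vq, Bq) is V/U with the form induced by B, and pi is the projection. *)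
Definition quotient_space (U : {vspace V}) : Prop :=
  [/\ lker pi = U, limg pi = fullv & isometry Bq B pi].

Definition positive_part (T : Type) n (x : 'I_n.+1 -> T) (i : 'I_n) : T :=
  x (lift ord0 i).

Definition span_fin (T : vectType R) n (x : 'I_n.+1 -> T) : {vspace T} :=
  <<[seq positive_part x i | i : 'I_n]>>%VS.

Definition affine_root_basis (Phi : set V) n (beta : 'I_n.+1 -> Vq) : Prop :=
  root_basis (pi @` Phi) beta /\
  exists Psi : set Vq,
    [/\ generalized_root_system Bq (span_fin beta) Psi, finite_set Psi
      & root_basis Psi (positive_part beta)].

(* The condition m_0 = 1 is what singles out beta_0 as the affine node. *)
Definition affine_marks (Phi : set V) n (beta : 'I_n.+1 -> Vq)
    (m : 'I_n.+1 -> nat) : Prop :=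
  [/\ m ord0 = 1%N, forall i, (0 < m i)%N
    & int_span (pi @` Phi) `&` [set` (pi @: radical B)%VS] =
      range (fun k : int => (\sum_i beta i *+ m i) *~ k)].

End AffineQuotient.

Section HyperbolicExtension.
Variables (R : realType) (V Vh : vectType R).
Variables (B : {symmetric V}) (Bh : {symmetric Vh}) (iota : 'Hom(V, Vh)).

(* V is viewed inside Vh through the injective isometry iota. *)
Record hyperbolic_extension (n : nat) (Vfin : {vspace V}) (a b : V)
    (a' b' : Vh) : Prop := HyperbolicExtension {
  hext_inj : lker iota = 0%VS;
  hext_isometry : isometry Bh B iota;
  hext_nondegenerate : nondegenerate Bh;
  hext_signature : has_signature Bh n.+2 2 0;
  hext_pair_a : hyperbolic_pair Bh (iota a) a';
  hext_pair_b : hyperbolic_pair Bh (iota b) b';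
  hext_sum :
    (iota @: Vfin + <<[:: iota a; a']>> + <<[:: iota b; b']>>)%VS = fullv;
  hext_direct :
    directv (iota @: Vfin + <<[:: iota a; a']>> + <<[:: iota b; b']>>);
  hext_ortho_a : (iota @: Vfin <= orthov Bh <<[:: iota a; a']>>)%VS;
  hext_ortho_b : (iota @: Vfin <= orthov Bh <<[:: iota b; b']>>)%VS;
  hext_ortho_ab :
    (<<[:: iota a; a']>> <= orthov Bh <<[:: iota b; b']>>)%VS
}.

Definition cover_space (b' : Vh) : {vspace Vh} := (limg iota + <[b']>)%VS.

End HyperbolicExtension.

Section GeneralLinearGroup.
Variables (R : realType) (V : vectType R).

Record GL := MkGL { GLfun :> 'End(V); _ : lker GLfun == 0%VS }.

HB.instance Definition _ := [isSub for GLfun].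
HB.instance Definition _ := [Choice of GL by <:].

Fact GL_one_subproof : lker (\1 : 'End(V))%VF == 0%VS.
Proof. by apply/lker0P=> x y; rewrite !id_lfunE. Qed.

Fact GL_mul_subproof (f g : GL) : lker (f \o g)%VF == 0%VS.
Proof.
apply/lker0P=> x y; rewrite !comp_lfunE.
by move/(lker0P (valP f))/(lker0P (valP g)).
Qed.

Fact GL_inv_subproof (f : GL) : lker (f^-1)%VF == 0%VS.
Proof. by apply/lker0P; exact: can_inj (lker0_lfunVK (valP f)). Qed.

Definition GL_one : GL := MkGL GL_one_subproof.
Definition GL_mul (f g : GL) : GL := MkGL (GL_mul_subproof f g).
Definition GL_inv (f : GL) : GL := MkGL (GL_inv_subproof f).

Fact GL_mulA : associative GL_mul.
Proof. by move=> f g h; apply: val_inj; rewrite /= comp_lfunA. Qed.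
Fact GL_mul1 : left_id GL_one GL_mul.
Proof. by move=> f; apply: val_inj; rewrite /= comp_lfun1l. Qed.
Fact GL_mulr1 : right_id GL_one GL_mul.
Proof. by move=> f; apply: val_inj; rewrite /= comp_lfun1r. Qed.
Fact GL_mulV : left_inverse GL_one GL_inv GL_mul.
Proof. by move=> f; apply: val_inj; exact: lker0_compVf (valP f). Qed.
Fact GL_mulrV : right_inverse GL_one GL_inv GL_mul.
Proof. by move=> f; apply: val_inj; exact: lker0_compfV (valP f). Qed.

HB.instance Definition _ :=
  isGroup.Build GL GL_mulA GL_mul1 GL_mulr1 GL_mulV GL_mulrV.

Variable B : {symmetric V}.

Fact reflection_linear (alpha : V) : linear (reflection B alpha).
Proof.
move=> k x y; rewrite /reflection linearPr /= scalerBr scalerA.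
rewrite [in RHS]addrACA -opprD -scalerDl; congr (_ - _ *: _).
by rewrite mulrDr mulrDl mulrCA -[in LHS](mulrA k).
Qed.

HB.instance Definition _ (alpha : V) :=
  GRing.isLinear.Build R V V *:%R (reflection B alpha) (reflection_linear alpha).

(* Since x / 0 = 0, the case of an isotropic alpha gives the identity. *)
Fact reflectionK (alpha : V) : involutive (reflection B alpha).
Proof.
move=> v; have [a0|a0] := eqVneq (B alpha alpha) 0.
  by rewrite /reflection a0 invr0 !mulr0 !scale0r !subr0.
have refl_neg : B alpha (reflection B alpha v) = - B alpha v.
  rewrite /reflection linearBr linearZr /= divfK // mulr2n mulrDl mul1r.
  by rewrite opprD addrA subrr add0r.
by rewrite {1}/reflection refl_neg mulrN mulNr scaleNr opprK subrK.
Qed.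

Fact reflection_subproof (alpha : V) :
  lker (linfun (reflection B alpha)) == 0%VS.
Proof.
by apply/lker0P=> x y; rewrite !lfunE; exact: (can_inj (reflectionK alpha)).
Qed.

Definition reflection_GL (alpha : V) : GL := MkGL (reflection_subproof alpha).

End GeneralLinearGroup.

Section CoxeterSystems.
Variable G : groupType.

(* Words in letters (x, false) and (x, true), which stand for x and x^-1. *)
Definition word := seq (G * bool).

Definition word_over (X : set G) (w : word) : Prop :=
  forall l, l \in w -> X l.1.

Definition word_val (w : word) : G :=
  (\prod_(l <- w) (if l.2 then l.1^-1 else l.1))%g.

Definition generated_subgroup (X : set G) : set G :=
  [set g | exists2 w, word_over X w & word_val w = g].

(* Equality, in the group with generators X and relators rel, of the elements
   represented by two words. *)
Inductive presented_eq (X : set G) (rel : set word) : word -> word -> Prop :=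
| presented_refl w : presented_eq X rel w w
| presented_sym w1 w2 : presented_eq X rel w1 w2 -> presented_eq X rel w2 w1
| presented_trans w1 w2 w3 : presented_eq X rel w1 w2 ->
    presented_eq X rel w2 w3 -> presented_eq X rel w1 w3
| presented_cancel u v x e : X x ->
    presented_eq X rel (u ++ [:: (x, e); (x, ~~ e)] ++ v) (u ++ v)
| presented_rel u v r : rel r -> presented_eq X rel (u ++ r ++ v) (u ++ v).

Definition has_presentation (W X : set G) (rel : set word) : Prop :=
  generated_subgroup X = W /\
  forall w, word_over X w ->
    (word_val w = 1%g <-> presented_eq X rel w [::]).

(* The value 0 encodes the entry infinity. *)
Definition coxeter_matrix (X : set G) (m : G -> G -> nat) : Prop :=
  (forall s, X s -> m s s = 1%N) /\
  (forall s t, X s -> X t -> s != t -> m s t = m t s /\ m s t != 1%N).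

Definition coxeter_relators (X : set G) (m : G -> G -> nat) : set word :=
  [set w | exists s t, [/\ X s, X t
     & w = flatten (nseq (m s t) [:: (s, false); (t, false)])]].

Definition coxeter_system (W X : set G) : Prop :=
  exists2 m, coxeter_matrix X m & has_presentation W X (coxeter_relators X m).

End CoxeterSystems.

Section HyperbolicCover.
Variables (R : realType) (V Vh : vectType R).
Variables (Bh : {symmetric Vh}) (iota : 'Hom(V, Vh)).

(* The index set {0, ..., n, t*} is option 'I_n.+1, with None for t*. *)
Definition extended_root n (alpha : 'I_n.+1 -> V) (t : 'I_n.+1) (a : V)
    (i : option 'I_n.+1) : V :=
  if i is Some j then alpha j else alpha t + a.

Definition cover_reflections n (alpha : 'I_n.+1 -> V) (t : 'I_n.+1) (a : V)
    (b' : Vh) : set (GL (subvs_of (cover_space iota b'))) :=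
  range (fun i => reflection_GL (restr_form Bh (U := cover_space iota b'))
                    (vsproj (cover_space iota b')
                       (iota (extended_root alpha t a i)))).

Arguments cover_reflections {n} alpha t a b'.

Definition hyperbolic_cover n (alpha : 'I_n.+1 -> V) (t : 'I_n.+1) (a : V)
    (b' : Vh) : set (GL (subvs_of (cover_space iota b'))) :=
  generated_subgroup (cover_reflections alpha t a b').

End HyperbolicCover.

Arguments hyperbolic_cover {R V Vh} Bh iota {n} alpha t a b'.

(* Main.v *)
Require Import Defs.
From HB Require Import structures.
From mathcomp Require Import all_boot all_order all_algebra.
From mathcomp Require Import all_classical all_reals.
Import Order.TTheory GRing.Theory Num.Theory.
Local Open Scope classical_set_scope.
Local Open Scope ring_scope.

(** The hyperbolic cover has a central element of infinite order, whereas a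
    central element of a Coxeter group squares to the identity.

    Coxeter side.  Attach to a word s_1 ... s_k in the generators the list of
    reflections s_1 ... s_(i-1) s_i s_(i-1) ... s_1, and to its value g the set
    N(g) of those that occur an odd number of times.  The Coxeter relators
    contribute each reflection evenly, so N(g) depends on g only
    ([word_val_parity]); it satisfies N(gh) = N(g) + g N(h) g^-1 (symmetric
    difference), and the exchange argument gives N(g) = 0 only for g = 1
    ([parity0_val]).  If z is central then N(z z) = N(z) + N(z) = 0, hence
    z z = 1 ([coxeter_center_sq]).

    Geometric side.  Since a lies in the radical of the form on the cover space,
    v |-> v + (x|v) a is a shear, additive in x.  The vectors x whose shear lies
    in the cover form a subgroup of the space.  It contains alpha_t, by the
    product of the reflections in alpha_t + a and alpha_t, and it is stable
    under the reflections; so with x it contains (alpha_j|x) alpha_j.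
    Consequently the set J of indices i such that some nonzero integral multiple
    of alpha_i belongs to it is closed under non-orthogonality
    ([shear_component]).  Let x be the sum of the m_i alpha_i over i in J.  As J
    is orthogonal to its complement and b is radical, x is radical; the marks say
    that its image in V/U is an integral multiple of that of b, and the
    coefficient at t, which lies in J, shows that the factor is 1, so x = b
    modulo U ([orthogonal_component_null_root]).  Thus (x|b') = 1, and a nonzero
    multiple of x gives a shear in the cover that is central because x is radical
    and of infinite order because it moves b' by a nonzero multiple of a
    ([central_shear_not_coxeter]). *)

Set Implicit Arguments.
Unset Strict Implicit.
Unset Printing Implicit Defensive.

(** * Subgroups generated by a set *)

Section GeneratedSubgroups.
Variables (G : groupType) (X : set G).
Local Open Scope group_scope.

Definition letter_val (l : G * bool) : G := if l.2 then l.1^-1 else l.1.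

Lemma word_val_cons l (w : word G) :
  word_val (l :: w) = letter_val l * word_val w.
Proof. by rewrite /word_val big_cons. Qed.

Lemma word_val_cat (u v : word G) : word_val (u ++ v) = word_val u * word_val v.
Proof. by rewrite /word_val big_cat. Qed.

Lemma word_over_cons l w : word_over X (l :: w) <-> X l.1 /\ word_over X w.
Proof.
split=> [Xw|[Xl Xw] l']; last by rewrite inE => /predU1P[-> //|/Xw].
by split=> [|l' wl']; apply: Xw; rewrite inE ?eqxx ?wl' ?orbT.
Qed.

Lemma word_over_cat u v :
  word_over X u -> word_over X v -> word_over X (u ++ v).
Proof. by move=> Xu Xv l; rewrite mem_cat => /orP[/Xu|/Xv]. Qed.

Lemma generated_subgroup_sub : X `<=` generated_subgroup X.
Proof.
move=> x Xx; exists [:: (x, false)]; first by move=> l /[!inE]/eqP->.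
by rewrite /word_val big_seq1.
Qed.

Lemma generated_subgroup1 : generated_subgroup X 1.
Proof. by exists [::] => //; rewrite /word_val big_nil. Qed.

Lemma generated_subgroupM g h : generated_subgroup X g ->
  generated_subgroup X h -> generated_subgroup X (g * h).
Proof.
move=> [u Xu <-] [v Xv <-]; exists (u ++ v); first exact: word_over_cat.
exact: word_val_cat.
Qed.

Lemma generated_subgroupV g :
  generated_subgroup X g -> generated_subgroup X g^-1.
Proof.
move=> [w + <-]; elim: w => [_|l w IHw /word_over_cons[Xl /IHw Xw]].
  by rewrite /word_val big_nil invg1; exact: generated_subgroup1.
rewrite word_val_cons invgM; apply: generated_subgroupM => //.
exists [:: (l.1, ~~ l.2)]; first by move=> l' /[!inE]/eqP->.
by rewrite word_val_cons /letter_val /= /word_val big_nil mulg1; case: l.2;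
  rewrite ?invgK.
Qed.

Lemma generated_subgroup_commute z g : (forall x, X x -> commute z x) ->
  generated_subgroup X g -> commute z g.
Proof.
move=> zX [w Xw <-]; rewrite /word_val big_seq; apply: commute_prod => l /Xw Xl.
by case: l.2; [apply: commuteV|]; apply: zX.
Qed.

End GeneratedSubgroups.

(** * The reflection cocycle on words *)

Section ReflectionParity.
Variable G : groupType.
Implicit Types (w : word G) (t : G).
Local Open Scope group_scope.

(** For a word s_1 ... s_k in involutions: the reflections
    s_1 ... s_(i-1) s_i s_(i-1) ... s_1.  The conjugating prefix keeps the signs
    of the letters, so that the concatenation rule holds for all words, as
    intermediate words of a derivation need not be words over the generators. *)
Fixpoint word_reflections w : seq G :=
  if w is l :: w' then
    l.1 :: [seq t ^ (letter_val l)^-1 | t <- word_reflections w']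
  else [::].

Lemma word_reflections_cat u v : word_reflections (u ++ v) =
  word_reflections u ++ [seq t ^ (word_val u)^-1 | t <- word_reflections v].
Proof.
elim: u => [|l u IHu] /=.
  rewrite /word_val big_nil invg1; under eq_map do rewrite conjg1.
  by rewrite map_id.
rewrite IHu map_cat -map_comp word_val_cons; congr (_ :: _ ++ _).
by apply: eq_map => t /=; rewrite invgM conjgM.
Qed.

(** The characteristic function of N(w); in a Coxeter group, the reflections whose
    walls separate the fundamental chamber from its translate by w. *)
Definition reflection_parity w t : bool :=
  odd (count_mem t (word_reflections w)).

(** The prefix u conjugates the reflections of v: N is a cocycle with values in
    sets of reflections under symmetric difference. *)
Lemma reflection_parity_cat u v t : reflection_parity (u ++ v) t =
  reflection_parity u t (+) reflection_parity v (t ^ word_val u).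
Proof.
rewrite /reflection_parity word_reflections_cat count_cat oddD count_map.
congr (_ (+) odd _); apply: eq_count => r /=.
by apply/eqP/eqP => [<-|->]; rewrite ?conjgKV ?conjgK.
Qed.

End ReflectionParity.

(** * Central elements of Coxeter groups *)

Section CoxeterCenter.
Variables (G : groupType) (W X : set G) (m : G -> G -> nat).
Hypothesis matrixP : coxeter_matrix X m.
Hypothesis presP : has_presentation W X (coxeter_relators X m).
Local Open Scope group_scope.

Lemma coxeter_relator_val r : coxeter_relators X m r -> word_val r = 1.
Proof.
move=> Rr; have [s [t [Xs Xt r_def]]] := Rr.
apply/(presP.2 r).
  move=> l; rewrite r_def => /flattenP[q /nseqP[-> _]].
  by rewrite !inE => /orP[]/eqP->.
by have := presented_rel X [::] [::] Rr; rewrite cats0.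
Qed.

Lemma coxeter_generator_sq s : X s -> s * s = 1.
Proof.
move=> Xs; have: coxeter_relators X m [:: (s, false); (s, false)].
  by exists s, s; rewrite matrixP.1.
by move/coxeter_relator_val; rewrite /word_val big_cons big_seq1.
Qed.

Lemma coxeter_generatorV s : X s -> s^-1 = s.
Proof.
by move/coxeter_generator_sq => ss; rewrite -[RHS](mulKg s) ss mulg1.
Qed.

Lemma letter_val_over l : X l.1 -> letter_val l = l.1.
Proof. by rewrite /letter_val; case: l.2 => // /coxeter_generatorV. Qed.

(** Prefixes of the alternating word of s and t lie in a dihedral group, so its
    reflections run through (st)^i s in order; once (st)^k = 1 this list is
    periodic of period k, which makes the relators contribute evenly. *)
Lemma dihedral_word_reflections s t k : X s -> X t ->
  word_reflections (flatten (nseq k [:: (s, false); (t, false)])) =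
  [seq (s * t) ^+ i * s | i <- iota 0 k.*2].
Proof.
move=> Xs Xt; elim: k => //= k IHk; rewrite IHk.
rewrite /letter_val /= expg0 mul1g expg1 -!map_comp; congr [:: _, _ & _].
  by rewrite conjgE invgK coxeter_generatorV ?mulgA.
rewrite -[2%N]/(2 + 0)%N iotaDl -map_comp; apply: eq_map => i /=.
have sV : (s * t)^-1 = t * s by rewrite invgM !coxeter_generatorV.
rewrite -conjgM -invgM conjgE invgK sV expgS expgSr; set c := (s * t) ^+ i.
by rewrite -!mulgA.
Qed.

Lemma relator_parity r t : coxeter_relators X m r ->
  reflection_parity r t = false.
Proof.
move=> Rr; have r1 := coxeter_relator_val Rr.
have [x [y [Xx Xy r_def]]] := Rr.
have xy1 : (x * y) ^+ m x y = 1.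
  rewrite -[RHS]r1 r_def; elim: (m x y) => [|k IHk] /=.
    by rewrite /word_val big_nil.
  by rewrite expgS !word_val_cons /letter_val /= -IHk mulgA.
rewrite /reflection_parity r_def dihedral_word_reflections // -addnn iotaD.
rewrite map_cat add0n -{2}[m x y]addn0 iotaDl -map_comp.
under [X in _ ++ X]eq_map => i do rewrite /= expgnDr xy1 mul1g.
by rewrite count_cat oddD addbb.
Qed.

(** A cancelling pair contributes the same reflection twice, and so does every
    reflection of a relator; both have value 1, so the reflections of what
    follows them are unchanged. *)
Lemma presented_eq_parity w1 w2 :
  presented_eq X (coxeter_relators X m) w1 w2 ->
  reflection_parity w1 =1 reflection_parity w2.
Proof.
elim=> {w1 w2}
  [//|w1 w2 _ IH t //|w1 w2 w3 _ IH1 _ IH2 t|u v x e Xx t|u v r Rr t].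
- by rewrite IH1 IH2.
- rewrite !reflection_parity_cat; congr addb.
  have -> : word_val [:: (x, e); (x, ~~ e)] = 1.
    rewrite !word_val_cons /word_val big_nil mulg1 !letter_val_over //.
    exact: coxeter_generator_sq.
  rewrite conjg1 /reflection_parity /= letter_val_over //=.
  have -> : x ^ x^-1 = x by rewrite conjgE invgK mulgV mulg1.
  by rewrite addn0 oddD addbb.
- rewrite !reflection_parity_cat (relator_parity _ Rr).
  by rewrite (coxeter_relator_val Rr) conjg1.
Qed.

(** The presentation only speaks of words of value 1, so both words are compared
    through a common word for the inverse of their value. *)
Lemma word_val_parity w1 w2 : word_over X w1 -> word_over X w2 ->
  word_val w1 = word_val w2 -> reflection_parity w1 =1 reflection_parity w2.
Proof.
move=> Xw1 Xw2 w12 t.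
(* w' is a word for the inverse of the common value. *)
have: generated_subgroup X (word_val w1) by exists w1.
move=> /generated_subgroupV[w' Xw' w'V].
have cat0 w : word_over X w -> word_val w = word_val w1 ->
    reflection_parity w t = reflection_parity w' (t ^ word_val w1).
  move=> Xw ww1.
  have ww'1 : word_val (w ++ w') = 1 by rewrite word_val_cat w'V ww1 mulgV.
  have := presented_eq_parity ((presP.2 _ (word_over_cat Xw Xw')).1 ww'1) t.
  rewrite reflection_parity_cat ww1.
  by case: reflection_parity; case: reflection_parity.
by rewrite !cat0.
Qed.

Lemma word_reflections_generated w t : word_over X w ->
  t \in word_reflections w -> generated_subgroup X t.
Proof.
elim: w t => //= l w IHw t /word_over_cons[Xl Xw].
have Wl := generated_subgroup_sub Xl.
rewrite inE letter_val_over // => /predU1P[-> //|/mapP[r wr ->]].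
rewrite conjgE invgK; apply: generated_subgroupM => //.
by apply: generated_subgroupM (IHw _ Xw wr) _; exact: generated_subgroupV.
Qed.

(** The exchange property: the prefix of the i-th reflection cancels against that
    of w, and its middle letter against the i-th letter, which is thus deleted. *)
Lemma delete_letter w t : word_over X w -> t \in word_reflections w ->
  exists2 w', word_over X w' &
    (size w' < size w)%N /\ word_val w' = t * word_val w.
Proof.
elim: w t => //= l w IHw t /word_over_cons[Xl Xw].
rewrite inE word_val_cons letter_val_over // => /predU1P[->|/mapP[r wr ->]].
  by exists w; rewrite // mulgA coxeter_generator_sq // mul1g.
have [w' Xw' [szw' w'_val]] := IHw r Xw wr.
exists (l :: w'); first exact/word_over_cons.
by rewrite word_val_cons letter_val_over // w'_val conjgE invgK -!mulgA mulKg.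
Qed.

(** In a nonempty word the first letter is itself a reflection; if it occurs an
    even number of times it occurs again in the tail, and the word can be
    shortened without changing its value, hence without changing its parities. *)
Lemma parity0_val w : word_over X w ->
  reflection_parity w =1 xpred0 -> word_val w = 1.
Proof.
have [k] := ubnP (size w); elim: k w => // k IHk [|l w] szw Xlw par0.
  by rewrite /word_val big_nil.
have [Xl Xw] := (word_over_cons _ _ _).1 Xlw.
have lw : l.1 \in word_reflections w.
  have := par0 l.1; rewrite /reflection_parity /= eqxx oddD /=.
  move=> /negbFE/odd_gt0; rewrite -has_count => /hasP[_ /mapP[r wr ->]] /eqP.
  rewrite letter_val_over // => /(canRL (conjgKV _)) r_def.
  by move: wr; rewrite r_def conjgE mulKg.
have [w' Xw' [szw' w'_val]] := delete_letter Xw lw.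
have ww' : word_val w' = word_val (l :: w).
  by rewrite word_val_cons letter_val_over.
rewrite -ww'; apply: IHk => // [|t]; last by rewrite (word_val_parity Xw' Xlw).
exact: ltn_trans szw' szw.
Qed.

(** Conjugation by z fixes every reflection, so N(zz) = N(z) + N(z) is empty. *)
Lemma coxeter_center_sq z : W z -> (forall x, X x -> commute z x) -> z * z = 1.
Proof.
rewrite -presP.1 => -[w Xw <-] zX; rewrite -word_val_cat.
apply: parity0_val => [|t]; first exact: word_over_cat.
rewrite reflection_parity_cat.
suff -> : reflection_parity w (t ^ word_val w) = reflection_parity w t.
  by rewrite addbb.
congr odd; apply: eq_in_count => r wr /=.
(* Every reflection of w is a product of generators, so z centralizes it. *)
have /conjg_fixP : [~ r, word_val w] == 1.
  apply/commgP/commute_sym; apply: generated_subgroup_commute zX _.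
  exact: word_reflections_generated wr.
by move=> {1}<-; rewrite (inj_eq (conjg_inj _)).
Qed.

End CoxeterCenter.

(** * Shears along a radical vector *)

Section Shears.
Variables (R : realType) (E : vectType R) (B : {symmetric E}).
Variables (a : E) (S : set (GL E)).
Hypothesis a_radical : forall v, B a v = 0.
Implicit Types (r x y v : E).

Definition in_shear_group x : Prop :=
  exists2 g, generated_subgroup S g & forall v, g v = v + B x v *: a.

Lemma GL_mulE (g h : GL E) v : (g * h)%g v = g (h v).
Proof. exact: comp_lfunE. Qed.

Lemma GL_oneE v : (1%g : GL E) v = v.
Proof. exact: id_lfunE. Qed.

Lemma reflection_GLE r v : reflection_GL B r v = reflection B r v.
Proof. exact: lfunE. Qed.

Lemma form_sym x y : B x y = B y x.
Proof. by rewrite hermC mul1r. Qed.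

Lemma form_radical v : B v a = 0.
Proof. by rewrite form_sym a_radical. Qed.

Lemma reflection_norm2 r v : B r r = 2 -> reflection B r v = v - B r v *: r.
Proof. by move=> r2; rewrite /reflection r2 mulrC mulKf ?pnatr_eq0. Qed.

Lemma reflection_shear r v c :
  reflection B r (v + c *: a) = reflection B r v + c *: a.
Proof.
rewrite /reflection linearDr linearZr_LR /= form_radical mulr0 addr0.
by rewrite addrAC.
Qed.

Lemma reflection_adjoint r x v :
  B (reflection B r x) v = B x (reflection B r v).
Proof.
rewrite /reflection linearBl linearBr linearZl_LR linearZr_LR /=; congr (_ - _).
by rewrite (form_sym x r) mulrAC [in RHS]mulrAC; congr (_ / _); exact: mulrAC.
Qed.

Lemma linearMz_l x k v : B (x *~ k) v = B x v *~ k.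
Proof. by rewrite !(form_sym _ v) raddfMz. Qed.

Lemma shear0 : in_shear_group 0.
Proof.
exists 1%g => [|v]; first exact: generated_subgroup1.
by rewrite GL_oneE linear0l scale0r addr0.
Qed.

Lemma shearD x y :
  in_shear_group x -> in_shear_group y -> in_shear_group (x + y).
Proof.
move=> [g Wg gE] [h Wh hE]; exists (g * h)%g => [|v].
  exact: generated_subgroupM.
rewrite GL_mulE hE gE linearDr linearZr_LR /= form_radical mulr0 addr0.
by rewrite linearDl /= scalerDl addrA addrAC.
Qed.

Lemma shearN x : in_shear_group x -> in_shear_group (- x).
Proof.
move=> [g Wg gE]; exists g^-1%g => [|v]; first exact: generated_subgroupV.
have {1}-> : v = g (v + B (- x) v *: a).
  rewrite gE linearDr linearZr_LR /= form_radical mulr0 addr0 linearNl scaleNr.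
  by rewrite subrK.
by rewrite -GL_mulE mulVg GL_oneE.
Qed.

Lemma shearMz x k : in_shear_group x -> in_shear_group (x *~ k).
Proof.
move=> Gx; have Gxn n : in_shear_group (x *+ n).
  by elim: n => [|n IHn]; rewrite ?mulr0n ?mulrS; [exact: shear0|exact: shearD].
by case: k => n; rewrite ?NegzE ?mulrNz; [|apply: shearN]; exact: Gxn.
Qed.

(** Conjugating the shear of x by the reflection s_r yields the shear of s_r x,
    and x - s_r x = (r|x) r. *)
Lemma shear_pairing r x : B r r = 2 -> S (reflection_GL B r) ->
  in_shear_group x -> in_shear_group (B r x *: r).
Proof.
move=> r2 Sr Gx; have -> : B r x *: r = x - reflection B r x.
  by rewrite reflection_norm2 // opprB addrC subrK.
apply/(shearD Gx)/shearN; have [g Wg gE] := Gx.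
have Wr := generated_subgroup_sub Sr.
exists (reflection_GL B r * (g * reflection_GL B r))%g => [|v].
  by do 2![apply: generated_subgroupM => //].
rewrite !GL_mulE !reflection_GLE gE reflection_shear reflectionK.
by rewrite reflection_adjoint.
Qed.

(** The reflections in r and r + a agree modulo the radical vector a, so their
    product is the identity modulo a. *)
Lemma shear_root r : B r r = 2 -> S (reflection_GL B r) ->
  S (reflection_GL B (r + a)) -> in_shear_group r.
Proof.
move=> r2 /generated_subgroup_sub Wr /generated_subgroup_sub Wra.
exists (reflection_GL B (r + a) * reflection_GL B r)%g => [|v].
  exact: generated_subgroupM.
have Bra y : B (r + a) y = B r y by rewrite linearDl /= a_radical addr0.
rewrite GL_mulE !reflection_GLE reflection_norm2 ?Bra; last first.
  by rewrite linearDr /= r2 form_radical addr0.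
rewrite reflection_norm2 // linearBr linearZr_LR /= r2.
rewrite mulr2n mulrDr mulr1 opprD addrA subrr sub0r scaleNr opprK scalerDr.
by rewrite addrA subrK.
Qed.

Lemma shear_commute r x (g : GL E) : (forall v, g v = v + B x v *: a) ->
  B x r = 0 -> commute g (reflection_GL B r).
Proof.
move=> gE xr; apply: val_inj; apply/lfunP => v.
rewrite -[LHS]/((g * _)%g v) -[RHS]/((_ * g)%g v) !GL_mulE !gE !reflection_GLE.
rewrite reflection_shear {2}/reflection linearBr linearZr_LR /= xr mulr0.
by rewrite subr0.
Qed.

(** Passing to nonzero integral multiples avoids keeping track of the integers
    that [shear_pairing] produces. *)
Definition virtual_shear x : Prop :=
  exists2 k : int, k != 0 & in_shear_group (x *~ k).

Lemma virtual_shear0 : virtual_shear 0.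
Proof. by exists 1 => //; rewrite mul0rz; exact: shear0. Qed.

Lemma virtual_shearD x y :
  virtual_shear x -> virtual_shear y -> virtual_shear (x + y).
Proof.
move=> [k k0 Gx] [l l0 Gy]; exists (k * l); first by rewrite mulf_neq0.
rewrite mulrzDl; apply: shearD; first by rewrite mulrzA; exact: shearMz.
by rewrite mulrC mulrzA; exact: shearMz.
Qed.

Lemma virtual_shearMn x n : virtual_shear x -> virtual_shear (x *+ n).
Proof.
move=> Gx; elim: n => [|n IHn]; first exact: virtual_shear0.
by rewrite mulrS; exact: virtual_shearD.
Qed.

Lemma virtual_shear_pairing r x : B r r = 2 -> S (reflection_GL B r) ->
  B r x \is a Num.int -> B r x != 0 -> virtual_shear x -> virtual_shear r.
Proof.
move=> r2 Sr /intrP[p Brx] p0 [k k0 Gx]; exists (p * k).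
  by rewrite mulf_neq0 //; apply: contraNneq p0 => p0; rewrite Brx p0.
have := shear_pairing r2 Sr Gx; rewrite raddfMz /= Brx.
by rewrite mulrzA -scalerMzl scaler_int.
Qed.

(** J consists of all i such that a nonzero multiple of r i has its shear in the
    group.  By [virtual_shear_pairing] an index that is not orthogonal to one in J
    belongs to J, so J is a union of components of the Dynkin diagram, one of
    which is that of t. *)
Lemma shear_component (I : finType) (r : I -> E) (m : I -> nat) (t : I) :
  (forall i, B (r i) (r i) = 2) -> (forall i j, B (r i) (r j) \is a Num.int) ->
  (forall i, S (reflection_GL B (r i))) -> S (reflection_GL B (r t + a)) ->
  exists J : pred I, [/\ J t, forall i j, J i -> ~~ J j -> B (r i) (r j) = 0
    & virtual_shear (\sum_(i | J i) r i *+ m i)].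
Proof.
move=> r2 rint Sr Sta; exists (fun i => `[< virtual_shear (r i) >]); split.
- apply/asboolP; exists 1 => //; rewrite mulr1z.
  exact: (shear_root (r2 t) (Sr t) Sta).
- move=> i j /asboolP Gi /asboolP Gj; apply/eqP/negPn/negP => ij0; apply: Gj.
  rewrite form_sym in ij0.
  exact: virtual_shear_pairing (r2 j) (Sr j) (rint j i) ij0 Gi.
- apply: big_ind => [|x y|i /asboolP Gi]; first exact: virtual_shear0.
    exact: virtual_shearD.
  exact: virtual_shearMn.
Qed.

(** If k x has its shear in the group, this shear commutes with the generators, as
    x is orthogonal to their roots.  Its square moves v by 2k (x|v) a, which
    contradicts [coxeter_center_sq]. *)
Lemma central_shear_not_coxeter x v : a != 0 -> virtual_shear x ->
  B x v != 0 ->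
  (forall s, S s -> exists2 r, s = reflection_GL B r & B x r = 0) ->
  ~ exists X, coxeter_system (generated_subgroup S) X.
Proof.
move=> a0 [k k0 [g Wg gE]] xv Sx [X [m matX presX]].
have gS s : S s -> commute g s.
  move=> /Sx[r -> xr]; apply: shear_commute gE _.
  by rewrite linearMz_l xr mul0rz.
have gX (h : GL E) : X h -> commute g h.
  move=> Xh; apply: generated_subgroup_commute gS _.
  by rewrite -presX.1; exact: generated_subgroup_sub.
have := coxeter_center_sq matX presX Wg gX.
move=> /(congr1 (fun h : GL E => h v)); rewrite GL_mulE GL_oneE !gE.
rewrite linearDr linearZr_LR /= form_radical mulr0 addr0 -addrA -scalerDl.
move=> /eqP; rewrite -subr_eq0 addrAC subrr add0r scaler_eq0 (negPf a0) orbF.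
rewrite -mulr2n mulrn_eq0 /= linearMz_l -mulrzl mulf_eq0 intr_eq0.
by rewrite (negPf k0) (negPf xv).
Qed.

End Shears.

(** * The null root and orthogonal components of the simple roots *)

Section Radical.
Variables (R : realType) (V Vq : vectType R) (B : {symmetric V}).
Variables (n : nat) (Phi : set V) (U : {vspace V}) (pi : 'Hom(V, Vq)).
Variables (beta : 'I_n.+1 -> Vq) (m : 'I_n.+1 -> nat) (alpha : 'I_n.+1 -> V).
Hypothesis Phi_span : real_span Phi = [set` (fullv : {vspace V})].
Hypothesis U_rad : (U <= radical B)%VS.
Hypothesis ker_pi : lker pi = U.
Hypothesis beta_basis : root_basis (pi @` Phi) beta.
Hypothesis marks : affine_marks B pi Phi beta m.
Hypothesis alpha_root : forall i, Phi (alpha i).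
Hypothesis alpha_beta : forall i, pi (alpha i) = beta i.

Lemma radicalP x : reflect (forall v, B x v = 0) (x \in radical B).
Proof.
by apply: (iffP mem_orthovP) => [xV v|xV v _]; rewrite xV ?memvf.
Qed.

Lemma pi_eq x y : pi x = pi y -> x - y \in U.
Proof. by move=> xy; rewrite -ker_pi memv_ker linearB /= xy subrr. Qed.

Lemma pi_sum (P : pred 'I_n.+1) (c : 'I_n.+1 -> nat) :
  pi (\sum_(i | P i) alpha i *+ c i) = \sum_(i | P i) beta i *+ c i.
Proof.
by rewrite linear_sum; apply: eq_bigr => i _; rewrite raddfMn /= alpha_beta.
Qed.

Lemma radical_eqmod x y : x - y \in U -> (x \in radical B) = (y \in radical B).
Proof. by move=> /(subvP U_rad) xy; rewrite -[x](subrK y) rpredDl. Qed.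

(** The simple roots and U together span the space, and U is radical. *)
Lemma radical_on_simple x : (forall i, B x (alpha i) = 0) -> x \in radical B.
Proof.
move=> x_alpha.
have xU u : u \in U -> B x u = 0.
  by move=> /(subvP U_rad)/radicalP uV; rewrite form_sym uV.
have xsum c : B x (\sum_i alpha i *+ c i) = 0.
  by rewrite linear_sum big1 // => i _; rewrite raddfMn /= x_alpha mul0rn.
have xPhi y : Phi y -> B x y = 0.
  move=> Py; have [_ _ /(_ (pi y))[|c]] := beta_basis; first by exists y.
  rewrite -!pi_sum -linearN => -[] /pi_eq/xU.
    by rewrite linearBr /= xsum subr0.
  by rewrite linearBr linearNr /= xsum oppr0 subr0.
apply/radicalP => v; have : [set` (fullv : {vspace V})] v by rewrite /= memvf.
rewrite -Phi_span => -[s sPhi /(@coord_span _ _ _ (in_tuple s))->].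
rewrite linear_sum big1 // => i _; rewrite /= linearZr_LR /= xPhi ?mulr0 //.
by apply: sPhi; rewrite /= mem_nth.
Qed.

(** The marks place the image of b in the image of the radical, and the kernel U
    of the projection is itself radical. *)
Lemma null_root_radical : \sum_i alpha i *+ m i \in radical B.
Proof.
have [_ _ spanZ] := marks.
have : range (fun k : int => (\sum_i beta i *+ m i) *~ k)
    (\sum_i beta i *+ m i).
  by exists 1.
rewrite -spanZ => -[_ /memv_imgP[r r_rad]]; rewrite -pi_sum => /pi_eq.
by move=> /radical_eqmod->.
Qed.

(** The partial sum over J is radical because the full sum b is and the rest is
    orthogonal to J.  Its image is then k times that of b by the choice of the
    marks, and comparing the coefficients at t gives k = 1. *)
Lemma orthogonal_component_null_root (J : pred 'I_n.+1) t :
  J t -> (forall i j, J i -> ~~ J j -> B (alpha i) (alpha j) = 0) ->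
  \sum_(i | J i) alpha i *+ m i - \sum_i alpha i *+ m i \in U.
Proof.
move=> Jt J_orth; have [_ m_gt0 spanZ] := marks; set x := \sum_(i | J i) _.
have x_rad : x \in radical B.
  have sumB j (P : pred 'I_n.+1) :
      (forall i, P i -> B (alpha i) (alpha j) = 0) ->
      B (\sum_(i | P i) alpha i *+ m i) (alpha j) = 0.
    move=> Pj; rewrite form_sym linear_sum big1 // => i Pi.
    by rewrite raddfMn /= form_sym Pj ?mul0rn.
  apply: radical_on_simple => j; have [Jj|J'j] := boolP (J j); last first.
    by apply: sumB => i Ji; exact: J_orth.
  have /radicalP/(_ (alpha j)) := null_root_radical.
  rewrite (bigID J) linearDl /= [X in _ + X]sumB ?addr0 // => i J'i.
  by rewrite form_sym J_orth.
have : range (fun k : int => (\sum_i beta i *+ m i) *~ k) (pi x).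
  rewrite -spanZ; split; last exact: memv_img.
  exists n.+1, (mktuple beta); split.
    by move=> _ /mapP[i _ ->]; exists (alpha i).
  exists [ffun i => if J i then (m i)%:Z else 0].
  rewrite pi_sum big_mkcond; apply: eq_bigr => i _.
  by rewrite -tnth_nth tnth_mktuple ffunE; case: (J i).
move=> [k _]; rewrite /= pi_sum => kb.
have [_ /(@freeP _ _ _ (mktuple beta)) beta_free _] := beta_basis.
(* The coefficients of k b - x with respect to the simple roots. *)
pose c i : R := k%:~R * (m i)%:R - (if J i then (m i)%:R else 0).
have /(beta_free c)/(_ t) : \sum_(i < n.+1) c i *: (mktuple beta)`_i = 0.
  transitivity ((\sum_i beta i *+ m i) *~ k - \sum_(i | J i) beta i *+ m i).
    rewrite mulrz_suml [in X in _ - X]big_mkcond -sumrB; apply: eq_bigr => i _.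
    rewrite -tnth_nth tnth_mktuple scalerBl -scalerA scaler_nat scaler_int.
    by case: (J i); rewrite ?scaler_nat ?scale0r.
  by rewrite kb subrr.
rewrite /c Jt -[X in _ - X]mul1r -mulrBl => /eqP; rewrite mulf_eq0 pnatr_eq0.
rewrite -[m t == 0%N]negbK -lt0n m_gt0 orbF subr_eq0 (eqr_int _ k 1) => /eqP k1.
by apply: pi_eq; rewrite !pi_sum -kb k1.
Qed.

End Radical.

(** * The hyperbolic cover *)

Theorem theorem3p20 (R : realType) (V : vectType R) (B : {symmetric V})
    (n : nat) (Phi : set V)
    (ell : elliptic_root_system B n Phi)
    (norm2 : forall x, Phi x -> B x x = 2)
    (U : {vspace V}) (a : V)
    (dimU : \dim U = 1%N) (U_rad : (U <= radical B)%VS)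
    (U_lattice : exists2 x, int_span Phi x /\ x \in U & x <> 0)
    (a_gen : int_span Phi `&` [set` U] = range (fun k : int => a *~ k))
    (Vq : vectType R) (Bq : {symmetric Vq}) (pi : 'Hom(V, Vq))
    (quot : quotient_space B Bq pi U)
    (beta : 'I_n.+1 -> Vq) (m : 'I_n.+1 -> nat)
    (beta_basis : affine_root_basis Bq pi Phi beta)
    (marks : affine_marks B pi Phi beta m)
    (alpha : 'I_n.+1 -> V)
    (alpha_root : forall i, Phi (alpha i))
    (alpha_beta : forall i, pi (alpha i) = beta i)
    (t : 'I_n.+1)
    (tubular : forall i, i <> t -> (m i < m t)%N)
    (Vh : vectType R) (Bh : {symmetric Vh}) (iota : 'Hom(V, Vh)) (a' b' : Vh)
    (hyp : hyperbolic_extension B Bh iota n (span_fin alpha)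
             a (\sum_i alpha i *+ m i) a' b') :
  ~ exists X : set (GL (subvs_of (cover_space iota b'))),
      X `<=` hyperbolic_cover Bh iota alpha t a b' /\
      coxeter_system (hyperbolic_cover Bh iota alpha t a b') X.
Proof.
case=> X [_ coxX].
have [[_ _ Phi_span _ Phi_int _] _ _ _] := ell.
have [ker_pi _ _] := quot.
have [_ bh_iota _ _ _ [_ _ bb'] _ _ _ _ orth_ab] := hyp.
have aU : a \in U.
  have : range (fun k : int => a *~ k) a by exists 1.
  by rewrite -a_gen => -[].
have a_rad : forall v, B a v = 0 by apply/radicalP/(subvP U_rad).
have aa' : Bh (iota a) a' = 1 by have [_ _ _ _ []] := hyp.
have ab' : Bh (iota a) b' = 0.
  by move/orthovP: orth_ab; apply; rewrite memv_span // !inE eqxx ?orbT.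
have iota0 : iota a != 0.
  by apply/eqP => ia0; move/eqP: aa'; rewrite ia0 linear0l eq_sym oner_eq0.
(* So x = b modulo U will mean that x - b is a multiple of a, orthogonal to b'. *)
have U_line : (U = <[a]>)%VS.
  apply/esym/eqP; rewrite eqEdim -memvE aU dimU dim_vline.
  by rewrite (_ : a != 0) //; apply: contra_neq iota0 => ->; rewrite linear0.
pose C := cover_space iota b'.
pose Bt : {symmetric _} := restr_form Bh (U := C).
pose lift x : subvs_of C := vsproj C (iota x).
have iotaC x : iota x \in C.
  by rewrite (subvP (addvSl _ _)) // memv_img ?memvf.
have liftE x : vsval (lift x) = iota x by rewrite vsprojK.
have liftB x y : Bt (lift x) (lift y) = B x y.
  by rewrite /Bt /= /restr_form !liftE bh_iota.
have b'C : b' \in C by rewrite (subvP (addvSr _ _)) ?memv_line.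
(* As a is orthogonal to b', it stays radical after b' is adjoined. *)
have lift_rad v : Bt (lift a) v = 0.
  have /memv_addP[_ /memv_imgP[y _ ->] [_ /vlineP[k ->] v_def]] := subvsP v.
  rewrite /Bt /= /restr_form liftE v_def linearDr linearZr_LR /= bh_iota a_rad.
  by rewrite ab' mulr0 addr0.
pose S := @cover_reflections R V Vh Bh iota n alpha t a b'.
have [J [Jt J_orth J_shear]] : exists J : pred 'I_n.+1,
  [/\ J t, forall i j, J i -> ~~ J j -> Bt (lift (alpha i)) (lift (alpha j)) = 0
    & virtual_shear Bt (lift a) S (\sum_(i | J i) lift (alpha i) *+ m i)].
  apply: shear_component => //.
  - by move=> i; rewrite liftB norm2.
  - move=> i j; rewrite liftB.
    have := Phi_int _ _ (alpha_root i) (alpha_root j).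
    by rewrite (norm2 _ (alpha_root j)) mulrC mulKf ?pnatr_eq0.
  - by move=> i; exists (Some i).
  - by exists None => //=; rewrite /lift !linearD.
have xb : \sum_(i | J i) alpha i *+ m i - \sum_i alpha i *+ m i \in U.
  apply: (orthogonal_component_null_root Phi_span U_rad ker_pi _ marks) => //.
  - by have [] := beta_basis.
  - exact: Jt.
  - by move=> i j Ji Jj; rewrite -liftB J_orth.
have x_sum : \sum_(i | J i) lift (alpha i) *+ m i =
    lift (\sum_(i | J i) alpha i *+ m i).
  rewrite /lift !linear_sum; apply: eq_bigr => i _.
  by rewrite !raddfMn.
rewrite x_sum in J_shear.
have x_rad : forall v, B (\sum_(i | J i) alpha i *+ m i) v = 0.
  apply/radicalP; rewrite (radical_eqmod U_rad xb).
  exact: (null_root_radical U_rad ker_pi marks).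
apply: (@central_shear_not_coxeter _ _ Bt (lift a) S lift_rad _ (vsproj C b') _
          J_shear).
- by apply: contra_neq iota0 => a0; rewrite -liftE a0 linear0.
- rewrite /Bt /= /restr_form liftE vsprojK //.
  move: xb; rewrite U_line => /vlineP[k xb].
  rewrite -[X in iota X](subrK (\sum_i alpha i *+ m i)) xb linearD linearZ /=.
  by rewrite linearDl linearZl_LR /= ab' bb' mulr0 add0r oner_neq0.
- move=> _ [i _ <-]; exists (lift (extended_root alpha t a i)) => //.
  by rewrite liftB x_rad.
- by exists X.
Qed.
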